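(* Let $ABCD$ be a tetrahedron of general form in Euclidean space $\mathbb{R}^3$, i.e. one which has exactly eight tangent spheres (spheres tangent to all four planes containing its faces). Then each of the four Euler cones of the trihedral angles of the tetrahedron (one at each of the vertices $A,B,C,D$) is tangent to all eight tangent spheres of the tetrahedron.
   Context: A tangent sphere of a tetrahedron is a sphere tangent to the four planes containing its faces; a tetrahedron of general form has eight of them (the inscribed sphere, four exscribed spheres, and three doubly-exscribed spheres). The excess of a trihedral angle is the sum of its three dihedral angles minus $180^\circ$. A mediator of a trihedral angle is a plane which contains one of its edges and divides it into two trihedral angles with equal excesses; there are three mediators, one through each edge. The foot of a mediator is the ray from the vertex along which the mediator meets the face of the trihedral angle opposite to the edge through which it passes. A circular cone means a (two-sided) right circular cone, i.e. the union of all lines through a point (the vertex) making a fixed angle with a fixed line through that point (the axis). The Euler cone of a trihedral angle is the circular cone, with vertex at the vertex of the trihedral angle, one nappe of which contains the feet (rays) of its three mediators. (It also contains the feet of the three so-called pseudo-altitudes: if $a,b,c$ are the edges, these feet are the lines $\mathfrak h_a,\mathfrak h_b,\mathfrak h_c$ through the vertex lying in the planes $\langle bc\rangle,\langle ac\rangle,\langle ab\rangle$ respectively, such that each of the quadruples $\{a,b,\mathfrak h_a,\mathfrak h_b\}$, $\{a,c,\mathfrak h_a,\mathfrak h_c\}$, $\{b,c,\mathfrak h_b,\mathfrak h_c\}$ consists of generators of one circular cone.) A cone is tangent to a sphere if they have a common point, different from the vertex of the cone, at which their tangent planes coincide. *)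

(* Defs.v *)
From HB Require Import structures.
From mathcomp Require Import all_boot all_order all_algebra.
From mathcomp Require Import all_classical all_reals all_analysis.

Set Implicit Arguments.
Unset Strict Implicit.
Unset Printing Implicit Defensive.

Import Order.TTheory GRing.Theory Num.Theory.

Local Open Scope classical_set_scope.
Local Open Scope ring_scope.

Section Euclidean.
Variable R : realType.

(* The points of Euclidean space and its vectors are both represented by
   ['rV[R]_3]. The library norm on row vectors is the sup norm, so the
   Euclidean one is defined here. *)
Local Notation point := 'rV[R]_3.
Implicit Types (V X Y Z O : point) (a b c n u : point) (P : set point).

Definition dot u n : R := \sum_(i < 3) u 0 i * n 0 i.

Definition enorm u : R := Num.sqrt (dot u u).

Definition vangle u n : R := acos (dot u n / (enorm u * enorm n)).

Definition plane_at X n : set point := [set Y | dot (Y - X) n = 0].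

Definition is_plane P := exists X n, n != 0 /\ P = plane_at X n.

Definition plane3 X Y Z : set point :=
  [set Q | exists s t : R, Q = X + s *: (Y - X) + t *: (Z - X)].

Definition ray V a : set point := [set Q | exists2 s : R, 0 <= s & Q = V + s *: a].

Definition sphere O (r : R) : set point := [set X | enorm (X - O) = r].

(* meaningful when X lies on the sphere centred at O, and X != O *)
Definition sphere_tangent_plane O X : set point := plane_at X (X - O).

Definition sphere_tangent_to_plane O (r : R) P :=
  exists2 X, sphere O r X & sphere_tangent_plane O X = P.

(* The radius is positive, so (O, r) is determined by the sphere. *)
Definition tangent_sphere (A B C D O : point) (r : R) :=
  0 < r /\
  [/\ sphere_tangent_to_plane O r (plane3 B C D),
      sphere_tangent_to_plane O r (plane3 A C D),
      sphere_tangent_to_plane O r (plane3 A B D) &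
      sphere_tangent_to_plane O r (plane3 A B C)].

(* A trihedral angle is given by its vertex V and by direction vectors a, b, c
   of its edges, which are the rays from V. *)
Definition trihedral a b c := free [:: a; b; c].

Definition face V b c : set point :=
  [set Q | exists s t : R, [/\ 0 <= s, 0 <= t & Q = V + s *: b + t *: c]].

Definition orth_part a b : point := b - (dot b a / dot a a) *: a.

(* The dihedral angle at the edge a: the angle between the perpendiculars to
   the edge drawn in the faces (a, b) and (a, c). *)
Definition dihedral a b c : R := vangle (orth_part a b) (orth_part a c).

Definition excess a b c : R :=
  dihedral a b c + dihedral b c a + dihedral c a b - pi.

(* P is the mediator through the edge a. A plane through the edge a which
   meets the opposite face along the ray f, not an edge of that face, divides
   the trihedral angle (a, b, c) into (a, b, f) and (a, f, c). *)
Definition mediator V a b c P :=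
  [/\ is_plane P, ray V a `<=` P &
      exists f, [/\ P `&` face V b c = ray V f,
                    trihedral a b f, trihedral a f c &
                    excess a b f = excess a f c]].

(* The nappe with vertex V around the ray from V in the direction u, with
   angle theta between that ray and the generators (V included). *)
Definition nappe V u (theta : R) : set point :=
  [set X | dot (X - V) u = enorm (X - V) * enorm u * cos theta].

Definition circular_cone V u (theta : R) : set point :=
  nappe V u theta `|` nappe V (- u) theta.

(* The normal vector is half the gradient at X of
   X |-> (dot (X - V) u) ^+ 2 - (cos theta) ^+ 2 * dot u u * dot (X - V) (X - V),
   whose zero set is the cone. Meaningful when X is on the cone and X != V. *)
Definition cone_tangent_plane V u (theta : R) X : set point :=
  plane_at X (dot (X - V) u *: u - (cos theta ^+ 2 * dot u u) *: (X - V)).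

(* The circular cone with vertex V, axis direction u and angle theta is the
   Euler cone of the trihedral angle (a, b, c) at V. As u and - u give the same
   cone, the nappe through the feet may be taken to be the one around u. *)
Definition euler_cone V a b c u (theta : R) :=
  [/\ u != 0, 0 < theta < pi / 2 &
      exists Pa Pb Pc : set point,
        [/\ mediator V a b c Pa, mediator V b c a Pb & mediator V c a b Pc] /\
        [/\ Pa `&` face V b c `<=` nappe V u theta,
            Pb `&` face V c a `<=` nappe V u theta &
            Pc `&` face V a b `<=` nappe V u theta]].

Definition cone_tangent_to_sphere V u (theta : R) O (r : R) :=
  exists X, [/\ X != V, circular_cone V u theta X, sphere O r X &
    cone_tangent_plane V u theta X = sphere_tangent_plane O X].

End Euclidean.

(* Main.v *)
(** On the unit sphere centred at a vertex V, the trihedral angle becomes a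
    spherical triangle, the feet of the mediators become the feet of its
    area-bisecting medians, and a tangent sphere projects onto a circle tangent
    to the three great circles carrying the sides. The theorem is then Hart's
    theorem: the circle through the three feet (the spherical analogue of the
    nine-point circle) is tangent to these circles.

    Let a, b, c be unit vectors along the edges and A, B, C the cosines of half
    the angles (b,c), (c,a), (a,b). The excess E satisfies
    cot (E / 2) = (1 + b.c + c.a + a.b) / |det(a,b,c)|, so the foot
    f = s b + t c of the mediator through a, normalised to be a unit vector,
    satisfies A (s C^2 + t B^2) = B C. Hence f.v = 1 for the vector v with
    v.a = BC/A, v.b = CA/B, v.c = AB/C, and by symmetry the Euler cone is
    |X - V| = (X - V).v up to sign.

    The centre O of a tangent sphere of radius r satisfies
    (O - V).(b x c) = 2 r A p with p^2 = 1 - A^2, and similarly with signed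
    half-sines q, m for the other two faces. With k = 2pqm / det(a,b,c) and
    l = (2r / det(a,b,c)) (pBC + AqC + ABm - pqm) one finds v.v = 1 + k^2,
    |O - V|^2 = l^2 + r^2 and (O - V).v = l + r k, which say that the two
    circles are tangent; the eight sign choices need no separate treatment. *)

Require Import Defs.
From mathcomp Require Import all_boot all_order all_algebra.
From mathcomp Require Import all_classical all_reals all_analysis.
From mathcomp Require Import ring lra.
Import Order.TTheory GRing.Theory Num.Theory.
Local Open Scope classical_set_scope.
Local Open Scope ring_scope.

(** * Vectors of R^3 *)

Section VectorAlgebra.
Set Implicit Arguments.
Unset Strict Implicit.
Variable R : realType.
Implicit Types (a b c d u v w : 'rV[R]_3) (k : R).

Lemma row3P u v :
  u 0 0 = v 0 0 -> u 0 1 = v 0 1 -> u 0 2%:R = v 0 2%:R -> u = v.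
Proof.
move=> u0 u1 u2; apply/rowP => -[[|[|[|//]]] lti].
- by have -> : Ordinal lti = 0 by apply/val_inj.
- by have -> : Ordinal lti = 1 by apply/val_inj.
- by have -> : Ordinal lti = 2%:R by apply/val_inj.
Qed.

Lemma dotE u v :
  dot u v = u 0 0 * v 0 0 + u 0 1 * v 0 1 + u 0 2%:R * v 0 2%:R.
Proof.
rewrite /dot !big_ord_recl big_ord0 addr0 addrA.
by congr (_ + _ * _ + _ * _); congr (_ 0 _); apply/val_inj.
Qed.

Lemma dotC u v : dot u v = dot v u.
Proof. by rewrite !dotE; ring. Qed.

Lemma dotDl u v w : dot (u + v) w = dot u w + dot v w.
Proof. by rewrite !dotE !mxE; ring. Qed.

Lemma dotZl k u w : dot (k *: u) w = k * dot u w.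
Proof. by rewrite !dotE !mxE; ring. Qed.

Lemma dotDr u v w : dot u (v + w) = dot u v + dot u w.
Proof. by rewrite !dotE !mxE; ring. Qed.

Lemma dotZr k u w : dot u (k *: w) = k * dot u w.
Proof. by rewrite !dotE !mxE; ring. Qed.

Lemma dotNl u w : dot (- u) w = - dot u w.
Proof. by rewrite !dotE !mxE; ring. Qed.

Lemma dotNr u w : dot u (- w) = - dot u w.
Proof. by rewrite !dotE !mxE; ring. Qed.

Lemma dot0l u : dot 0 u = 0.
Proof. by rewrite !dotE !mxE; ring. Qed.

Definition dotL := (dotDl, dotDr, dotNl, dotNr, dotZl, dotZr).

Lemma dot_ge0 u : 0 <= dot u u.
Proof. by rewrite dotE !addr_ge0 // -expr2 sqr_ge0. Qed.

Lemma dot_eq0 u : dot u u = 0 -> u = 0.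
Proof.
rewrite dotE => u0; have : [/\ u 0 0 = 0, u 0 1 = 0 & u 0 2%:R = 0].
  by split; nra.
by case=> e0 e1 e2; apply: row3P; rewrite mxE.
Qed.

(** Indices in ['I_3] add modulo 3, so one formula serves all three coordinates. *)
Definition cross u v : 'rV[R]_3 :=
  \row_i (u 0 (i + 1) * v 0 (i + 2%:R) - u 0 (i + 2%:R) * v 0 (i + 1)).

Lemma crossE u v :
  [/\ cross u v 0 0 = u 0 1 * v 0 2%:R - u 0 2%:R * v 0 1,
      cross u v 0 1 = u 0 2%:R * v 0 0 - u 0 0 * v 0 2%:R &
      cross u v 0 2%:R = u 0 0 * v 0 1 - u 0 1 * v 0 0].
Proof.
by split; rewrite mxE; congr (u 0 _ * v 0 _ - u 0 _ * v 0 _); apply/val_inj.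
Qed.

Definition triple a b c := dot a (cross b c).

Lemma tripleE a b c : triple a b c =
  a 0 0 * (b 0 1 * c 0 2%:R - b 0 2%:R * c 0 1)
  + a 0 1 * (b 0 2%:R * c 0 0 - b 0 0 * c 0 2%:R)
  + a 0 2%:R * (b 0 0 * c 0 1 - b 0 1 * c 0 0).
Proof. by rewrite /triple dotE; case: (crossE b c) => -> -> ->. Qed.

Lemma triple_cyc a b c : triple b c a = triple a b c.
Proof. by rewrite !tripleE; ring. Qed.

Lemma triple_comb k1 k2 a b c : triple a b (k1 *: b + k2 *: c) = k2 * triple a b c.
Proof. by rewrite !tripleE !mxE; ring. Qed.

Lemma triple_comb2 k1 k2 a b c : triple a (k1 *: b + k2 *: c) c = k1 * triple a b c.
Proof. by rewrite !tripleE !mxE; ring. Qed.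

Lemma triple_scale k1 k2 k3 a b c :
  triple (k1 *: a) (k2 *: b) (k3 *: c) = k1 * k2 * k3 * triple a b c.
Proof. by rewrite !tripleE !mxE; ring. Qed.

Lemma dot_crossl a b : dot a (cross a b) = 0.
Proof. by rewrite -/(triple _ _ _) tripleE; ring. Qed.

Lemma dot_crossr a b : dot b (cross a b) = 0.
Proof. by rewrite -/(triple _ _ _) tripleE; ring. Qed.

Lemma dot_cross a b c d :
  dot (cross a b) (cross c d) = dot a c * dot b d - dot a d * dot b c.
Proof.
rewrite 5!dotE; case: (crossE a b) => -> -> ->; case: (crossE c d) => -> -> ->.
ring.
Qed.

Lemma gram a b c : triple a b c ^+ 2 =
  dot a a * dot b b * dot c c + 2 * dot b c * dot c a * dot a b
  - dot a a * dot b c ^+ 2 - dot b b * dot c a ^+ 2 - dot c c * dot a b ^+ 2.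
Proof. by rewrite tripleE !dotE; ring. Qed.

(** Up to the factor [triple a b c], the three cross products are the basis dual to the edges; this
    recovers a vector from its products with the edges. *)
Lemma triple_cross_decomp a b c w : triple a b c *: w =
  dot w a *: cross b c + dot w b *: cross c a + dot w c *: cross a b.
Proof.
rewrite tripleE !dotE.
have [a0 a1 a2] := crossE b c; have [b0 b1 b2] := crossE c a.
have [c0 c1 c2] := crossE a b.
have coordE x y z (p q s : 'rV[R]_3) i :
  (x *: p + y *: q + z *: s) 0 i = x * p 0 i + y * q 0 i + z * s 0 i by rewrite !mxE.
apply: row3P; rewrite coordE mxE.
- by rewrite a0 b0 c0; ring.
- by rewrite a1 b1 c1; ring.
- by rewrite a2 b2 c2; ring.
Qed.

(** Cramer's rule; it recovers a vector from its products with the normals of the three faces. *)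
Lemma triple_decomp a b c w : triple a b c *: w =
  dot w (cross b c) *: a + dot w (cross c a) *: b + dot w (cross a b) *: c.
Proof.
rewrite -!/(triple _ _ _) !tripleE.
by apply: row3P; rewrite !mxE; ring.
Qed.

Lemma free3P a b c : free [:: a; b; c] <-> triple a b c != 0.
Proof.
have freeE : free [:: a; b; c] <->
    forall x y z : R, x *: a + y *: b + z *: c = 0 -> [/\ x = 0, y = 0 & z = 0].
  split=> [/freeP fr x y z e | h].
    have : forall i : 'I_3, tnth [tuple x; y; z] i = 0.
      apply: fr; rewrite !big_ord_recl big_ord0 /= addr0 addrA -[RHS]e.
      by rewrite !(tnth_nth 0).
    move=> k0; have := (k0 0, k0 1, k0 2%:R); rewrite !(tnth_nth 0) /=.
    by move=> [[-> ->] ->].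
  apply/freeP => k; rewrite !big_ord_recl big_ord0 /= addr0 addrA => e.
  have [k0 k1 k2] := h _ _ _ e => -[[|[|[|//]]] lti].
  - by rewrite -[RHS]k0; congr k; apply/val_inj.
  - by rewrite -[RHS]k1; congr k; apply/val_inj.
  - by rewrite -[RHS]k2; congr k; apply/val_inj.
rewrite freeE; split=> [h | D0 x y z e].
  (* With zero determinant, Cramer's rule for [cross b c] is a linear relation whose first
     coefficient is its squared length. Hence [b] and [c] are parallel, and a second relation gives
     [c = 0], which independence excludes. *)
  apply/eqP => D0.
  have bc0 : cross b c = 0.
    have := triple_decomp a b c (cross b c).
    by rewrite D0 scale0r => /esym/h[/dot_eq0].
  have e : dot c c *: b + - dot b c *: c = 0.
    have := dot_cross b c b c; rewrite bc0 dot0l => bc.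
    apply: dot_eq0; rewrite !dotL (dotC c b).
    transitivity (dot c c * (dot b b * dot c c - dot b c * dot b c)); first by ring.
    by rewrite -{2}(dotC c b) -bc mulr0.
  have [_ c0 _] : [/\ (0 : R) = 0, dot c c = 0 & - dot b c = 0].
    by apply: h; rewrite scale0r add0r.
  have [_ _ /eqP] : [/\ (0 : R) = 0, (0 : R) = 0 & (1 : R) = 0].
    by apply: h; rewrite !scale0r !add0r (dot_eq0 c0) scaler0.
  by rewrite oner_eq0.
have k0 w : dot (x *: a + y *: b + z *: c) w = 0 by rewrite e dot0l.
split; apply: (mulIf D0); rewrite mul0r.
- rewrite -(k0 (cross b c)) !dotL dot_crossl dot_crossr -/(triple a b c); ring.
- rewrite -(k0 (cross c a)) !dotL dot_crossl dot_crossr -(triple_cyc) -/(triple b c a); ring.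
- rewrite -(k0 (cross a b)) !dotL dot_crossl dot_crossr triple_cyc -/(triple c a b) -triple_cyc; ring.
Qed.

Lemma dual_vector a b c x y z : triple a b c != 0 ->
  exists w, [/\ dot w a = x, dot w b = y & dot w c = z].
Proof.
move=> D0; exists ((triple a b c)^-1 *: (x *: cross b c + y *: cross c a + z *: cross a b)).
have eb : dot (cross c a) b = triple a b c by rewrite dotC -/(triple b c a) triple_cyc.
have ec : dot (cross a b) c = triple a b c by rewrite dotC -/(triple c a b) -triple_cyc.
have ea : dot (cross b c) a = triple a b c by rewrite dotC.
have z1 u v : dot (cross u v) u = 0 by rewrite dotC dot_crossl.
have z2 u v : dot (cross u v) v = 0 by rewrite dotC dot_crossr.
by split; rewrite !dotL ?(ea, eb, ec, z1, z2); field.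
Qed.

Lemma eq_dual_vector a b c v w : triple a b c != 0 ->
  dot v a = dot w a -> dot v b = dot w b -> dot v c = dot w c -> v = w.
Proof.
move=> D0 ea eb ec; apply: (scalerI D0).
by rewrite !triple_cross_decomp ea eb ec.
Qed.

End VectorAlgebra.

(** * The excess of a trihedral angle *)

Section Excess.
Set Implicit Arguments.
Unset Strict Implicit.
Variable R : realType.
Implicit Types (a b c d u v w : 'rV[R]_3) (k : R).

Lemma enorm_sqr u : enorm u ^+ 2 = dot u u.
Proof. by rewrite sqr_sqrtr ?dot_ge0. Qed.

Lemma enorm_ge0 u : 0 <= enorm u.
Proof. exact: sqrtr_ge0. Qed.

Lemma enormZ k u : 0 <= k -> enorm (k *: u) = k * enorm u.
Proof.
move=> k0; rewrite /enorm !dotL mulrA -expr2 sqrtrM ?sqr_ge0//.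
by rewrite sqrtr_sqr ger0_norm.
Qed.

Lemma enorm_unit u : dot u u = 1 -> enorm u = 1.
Proof. by rewrite /enorm => ->; rewrite sqrtr1. Qed.

Lemma vangleC u v : vangle u v = vangle v u.
Proof. by rewrite /vangle dotC (mulrC (enorm u)). Qed.

Lemma vangleZl k u v : 0 < k -> vangle (k *: u) v = vangle u v.
Proof.
move=> k0; rewrite /vangle dotZl enormZ ?ltW// -(mulrA k (enorm u)) -mulf_div divff ?mul1r//.
by rewrite gt_eqF.
Qed.

Lemma vangleZr k u v : 0 < k -> vangle u (k *: v) = vangle u v.
Proof. by move=> k0; rewrite vangleC vangleZl// vangleC. Qed.

Lemma orth_partZl k a b : 0 < k -> orth_part (k *: a) b = orth_part a b.
Proof.
move=> k0; rewrite /orth_part !dotL scalerA; congr (_ - _ *: _).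
(* If [dot a a = 0], both quotients are 0 by the convention for the inverse of 0. *)
have [->|a0] := eqVneq (dot a a) 0; first by rewrite !mulr0 invr0; ring.
by field; rewrite a0 gt_eqF.
Qed.

Lemma orth_partZr k a b : orth_part a (k *: b) = k *: orth_part a b.
Proof. by rewrite /orth_part dotZl scalerBr scalerA -mulrA. Qed.

Lemma dihedralZ k1 k2 k3 a b c : 0 < k1 -> 0 < k2 -> 0 < k3 ->
  dihedral (k1 *: a) (k2 *: b) (k3 *: c) = dihedral a b c.
Proof.
by move=> *; rewrite /dihedral !orth_partZl// !orth_partZr vangleZl// vangleZr.
Qed.

(** The excess depends only on the rays, so edges may be normalised to unit vectors. *)
Lemma excessZ k1 k2 k3 a b c : 0 < k1 -> 0 < k2 -> 0 < k3 ->
  excess (k1 *: a) (k2 *: b) (k3 *: c) = excess a b c.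
Proof. by move=> *; rewrite /excess !dihedralZ. Qed.

(** The gap [1 - dot a b ^+ 2] is the squared length of [cross a b], which cannot vanish when the
    determinant does not. *)
Lemma dot_unit_lt1 a b c : dot a a = 1 -> dot b b = 1 ->
  triple a b c != 0 -> dot a b ^+ 2 < 1.
Proof.
move=> a1 b1 D0; rewrite -subr_gt0.
have e : dot (cross a b) (cross a b) = 1 - dot a b ^+ 2.
  by rewrite dot_cross a1 b1 (dotC b a); ring.
rewrite -e lt_neqAle dot_ge0 andbT eq_sym; apply: contra_neq D0 => /dot_eq0 ab0.
by rewrite -triple_cyc -triple_cyc /triple ab0 dotC dot0l.
Qed.

(** The cosine is the spherical law of cosines, [s] being the product of the lengths of the
    orthogonal parts. The sine follows because the Gram determinant is the numerator of 1 minus the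
    squared cosine. *)
Lemma dihedral_unit a b c : dot a a = 1 -> dot b b = 1 -> dot c c = 1 ->
    triple a b c != 0 ->
  let s := Num.sqrt (1 - dot a b ^+ 2) * Num.sqrt (1 - dot c a ^+ 2) in
  [/\ 0 < dihedral a b c < pi,
      cos (dihedral a b c) = (dot b c - dot c a * dot a b) / s &
      sin (dihedral a b c) = `|triple a b c| / s].
Proof.
move=> a1 b1 c1 D0 s.
have ab := dot_unit_lt1 a1 b1 D0.
have ca : dot c a ^+ 2 < 1.
  by apply: (dot_unit_lt1 (c := b)) => //; rewrite -triple_cyc.
have sb0 : 0 < Num.sqrt (1 - dot a b ^+ 2) by rewrite sqrtr_gt0 subr_gt0.
have sc0 : 0 < Num.sqrt (1 - dot c a ^+ 2) by rewrite sqrtr_gt0 subr_gt0.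
have s0 : 0 < s by rewrite mulr_gt0.
have s2 : s ^+ 2 = (1 - dot a b ^+ 2) * (1 - dot c a ^+ 2).
  by rewrite exprMn !sqr_sqrtr ?subr_ge0 ?ltW.
have q2 : 1 - ((dot b c - dot c a * dot a b) / s) ^+ 2
          = (triple a b c / s) ^+ 2.
  rewrite !expr_div_n s2 gram a1 b1 c1; field.
  by rewrite !subr_eq0 ![1 == _]eq_sym !lt_eqF.
have -> : dihedral a b c = acos ((dot b c - dot c a * dot a b) / s).
  rewrite /dihedral /vangle /orth_part a1 !divr1; congr acos; congr (_ / _).
    by rewrite !dotL a1 (dotC b a) (dotC a c); ring.
  rewrite /s /enorm; congr (Num.sqrt _ * Num.sqrt _).
    by rewrite !dotL a1 b1 (dotC b a); ring.
  by rewrite !dotL a1 c1 (dotC a c); ring.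
have q1 : -1 < (dot b c - dot c a * dot a b) / s < 1.
  rewrite -ltr_norml -(ltr_pXn2r (n := 2))// ?nnegrE// expr1n real_normK ?num_real//.
  rewrite -subr_gt0 q2 lt_neqAle sqr_ge0 andbT eq_sym sqrf_eq0 mulf_neq0 ?invr_eq0//.
  by rewrite gt_eqF.
have [q1l q1r] := andP q1; split.
- by rewrite acos_gt0 ?acos_ltpi ?q1l ?q1r ?ltW.
- by rewrite acosK// in_itv/= !ltW.
- by rewrite sin_acos ?(ltW q1l) ?(ltW q1r)// q2 sqrtr_sqr normrM normfV (gtr0_norm s0).
Qed.

(* [excess_num a b c / `|triple a b c|] is the cotangent of half the excess. *)
Definition excess_num a b c : R := 1 + dot b c + dot c a + dot a b.

(** Cosine and sine of an angle whose half has cotangent [p / d], cleared of denominators. Together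
    with the range they determine the excess, also when [p] is zero or negative. *)
Lemma excess_unit a b c : dot a a = 1 -> dot b b = 1 -> dot c c = 1 ->
    triple a b c != 0 ->
  let p := excess_num a b c in let d := `|triple a b c| in
  [/\ 0 < excess a b c < pi + pi,
      cos (excess a b c) * (p ^+ 2 + d ^+ 2) = p ^+ 2 - d ^+ 2 &
      sin (excess a b c) * (p ^+ 2 + d ^+ 2) = 2 * p * d].
Proof.
move=> a1 b1 c1 D0 p d.
have cyc1 := triple_cyc a b c.
have cyc2 : triple c a b = triple a b c by rewrite -triple_cyc.
have ab := dot_unit_lt1 a1 b1 D0.
have ca : dot c a ^+ 2 < 1 by apply: (dot_unit_lt1 (c := b)); rewrite ?cyc2.
have bc : dot b c ^+ 2 < 1 by apply: (dot_unit_lt1 (c := a)); rewrite ?cyc1.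
have d2 : d ^+ 2 = 1 + 2 * dot b c * dot c a * dot a b
    - dot b c ^+ 2 - dot c a ^+ 2 - dot a b ^+ 2.
  by rewrite /d real_normK ?num_real// gram a1 b1 c1; ring.
have d0 : 0 < d by rewrite normr_gt0.
have [] := dihedral_unit a1 b1 c1 D0.
have [] := dihedral_unit b1 c1 a1 (etrans (congr1 (fun t => t != 0) cyc1) D0).
have [] := dihedral_unit c1 a1 b1 (etrans (congr1 (fun t => t != 0) cyc2) D0).
rewrite cyc1 cyc2 -/d.
rewrite /excess {}/p /excess_num.
move: d d0 d2 ab bc ca {cyc1 cyc2} => d; move: (dot b c) (dot c a) (dot a b) => x y z.
move: (dihedral a b c) (dihedral b c a) (dihedral c a b) => al be ga.
move=> d0 d2 z1 x1 y1.
set sx := Num.sqrt (1 - x ^+ 2); set sy := Num.sqrt (1 - y ^+ 2).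
set sz := Num.sqrt (1 - z ^+ 2).
have [x0 y0 z0] : [/\ 0 < sx, 0 < sy & 0 < sz] by rewrite !sqrtr_gt0 !subr_gt0.
have x2 : sx ^+ 2 = 1 - x ^+ 2 by rewrite sqr_sqrtr ?subr_ge0 ?ltW.
have y2 : sy ^+ 2 = 1 - y ^+ 2 by rewrite sqr_sqrtr ?subr_ge0 ?ltW.
have z2 : sz ^+ 2 = 1 - z ^+ 2 by rewrite sqr_sqrtr ?subr_ge0 ?ltW.
move: sx sy sz x0 y0 z0 x2 y2 z2 => sx sy sz x0 y0 z0 x2 y2 z2.
move=> /andP[ga0 gapi] cga sga /andP[be0 bepi] cbe sbe /andP[al0 alpi] cal sal.
have nz : [/\ sx != 0, sy != 0 & sz != 0] by rewrite !gt_eqF.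
have [sx0 sy0 sz0] := nz.
split.
- apply/andP; split; last by lra.
  (* If the angle sum were at most [pi], monotonicity of the cosine would give
     [cos (pi - be - ga) <= cos al]; but [cos al + cos (be + ga)] is a negative multiple of
     [(1 - x) d^2]. *)
  rewrite subr_gt0 ltNge; apply/negP => le_pi.
  have : cos (pi - be - ga) <= cos al.
    rewrite leNgt ltr_cos ?in_itv/= -?leNgt; lra.
  have -> : pi - be - ga = - (be + ga) + pi by ring.
  rewrite cosDpi cosN cosD cal cbe cga sbe sga leNgt => /negP; apply.
  rewrite -subr_lt0.
  have -> : (x - y * z) / (sz * sy) - - ((y - z * x) / (sx * sz)
      * ((z - x * y) / (sy * sx)) - d / (sx * sz) * (d / (sy * sx)))
    = ((x - y * z) * sx ^+ 2 + (y - z * x) * (z - x * y) - d ^+ 2)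
      / (sx ^+ 2 * (sy * sz)).
    by field; rewrite sx0 sy0 sz0.
  have -> : (x - y * z) * sx ^+ 2 + (y - z * x) * (z - x * y) - d ^+ 2
      = - (1 - x) * d ^+ 2 by rewrite x2 d2; ring.
  have x_lt1 : x < 1 by nra.
  by rewrite !mulNr oppr_lt0 divr_gt0// mulr_gt0 ?exprn_gt0 ?subr_gt0 ?mulr_gt0.
- rewrite cosB cospi sinpi mulr0 addr0 mulrN1 !cosD !sinD
    cal cbe cga sal sbe sga.
  set lhs := (X in X * _).
  have -> : lhs = - ((x - y * z) * (y - z * x) * (z - x * y)
      - d ^+ 2 * (x - y * z + (y - z * x) + (z - x * y)))
      / (sx ^+ 2 * sy ^+ 2 * sz ^+ 2).
    by rewrite /lhs; field; rewrite sx0 sy0 sz0.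
  rewrite d2 x2 y2 z2; field.
  by rewrite -x2 -y2 -z2 !expf_neq0.
- rewrite sinB cospi sinpi mulr0 subr0 mulrN1 !sinD !cosD
    cal cbe cga sal sbe sga.
  set lhs := (X in X * _).
  have -> : lhs = - (((y - z * x) * (z - x * y) + (x - y * z) * (z - x * y)
      + (x - y * z) * (y - z * x) - d ^+ 2) * d)
      / (sx ^+ 2 * sy ^+ 2 * sz ^+ 2).
    by rewrite /lhs; field; rewrite sx0 sy0 sz0.
  rewrite d2 x2 y2 z2; field.
  by rewrite -x2 -y2 -z2 !expf_neq0.
Qed.

(** Both excesses lie strictly between 0 and 2pi, where the cotangent of the half is injective; the
    equation compares these cotangents, multiplied out. *)
Lemma eq_excess_unit a b c u v w :
    [/\ dot a a = 1, dot b b = 1 & dot c c = 1] ->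
    [/\ dot u u = 1, dot v v = 1 & dot w w = 1] ->
    triple a b c != 0 -> triple u v w != 0 ->
  excess a b c = excess u v w <->
  excess_num a b c * `|triple u v w| = excess_num u v w * `|triple a b c|.
Proof.
move=> [a1 b1 c1] [u1 v1 w1] D0 D0'.
have [] := excess_unit a1 b1 c1 D0; have [] := excess_unit u1 v1 w1 D0'.
move: D0 D0'; rewrite -!normr_gt0.
move: (excess a b c) (excess u v w) (excess_num a b c) (excess_num u v w).
move: (`|triple a b c|) (`|triple u v w|) => d1 d2 E1 E2 p1 p2 d1_gt0 d2_gt0.
move=> /andP[E20 E2pi] c2 s2 /andP[E10 E1pi] c1' s1.
have m1 : 0 < p1 ^+ 2 + d1 ^+ 2 by rewrite ltr_wpDl ?sqr_ge0 ?exprn_gt0.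
have m2 : 0 < p2 ^+ 2 + d2 ^+ 2 by rewrite ltr_wpDl ?sqr_ge0 ?exprn_gt0.
split=> [eE | ep].
  (* The half-angle formula [cot (E / 2) = sin E / (1 - cos E)]; the denominator is positive because
     [d] is. *)
  have half (E p d : R) : 0 < d -> 0 < p ^+ 2 + d ^+ 2 ->
      cos E * (p ^+ 2 + d ^+ 2) = p ^+ 2 - d ^+ 2 ->
      sin E * (p ^+ 2 + d ^+ 2) = 2 * p * d ->
      0 < 1 - cos E /\ p * (1 - cos E) = sin E * d.
    move=> d0 m0 cE sE.
    have cE' : (1 - cos E) * (p ^+ 2 + d ^+ 2) = 2 * d ^+ 2.
      by rewrite mulrBl cE; ring.
    split; first by rewrite -(pmulr_lgt0 _ m0) cE' mulr_gt0 ?exprn_gt0.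
    apply: (mulIf (lt0r_neq0 m0)); rewrite -mulrA cE' mulrAC sE; ring.
  have [k1 h1] := half _ _ _ d1_gt0 m1 c1' s1.
  have [k2 h2] := half _ _ _ d2_gt0 m2 c2 s2.
  rewrite -eE in h2; apply: (mulIf (lt0r_neq0 k1)).
  by rewrite mulrAC h1 [RHS]mulrAC h2; ring.
(* Once this cosine is 1, half the difference has sine 0 and lies strictly between [- pi] and [pi],
   so it vanishes. *)
have c12 : cos (E1 - E2) = 1.
  rewrite cosB; apply: (mulIf (lt0r_neq0 (mulr_gt0 m1 m2))).
  transitivity ((cos E1 * (p1 ^+ 2 + d1 ^+ 2)) * (cos E2 * (p2 ^+ 2 + d2 ^+ 2))
      + (sin E1 * (p1 ^+ 2 + d1 ^+ 2)) * (sin E2 * (p2 ^+ 2 + d2 ^+ 2))).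
    by ring.
  rewrite c1' c2 s1 s2.
  transitivity ((p1 ^+ 2 + d1 ^+ 2) * (p2 ^+ 2 + d2 ^+ 2)
     - 2 * (p1 * d2 - p2 * d1) ^+ 2); first by ring.
  by rewrite ep; ring.
pose h := (E1 - E2) / 2.
have eh : E1 - E2 = h *+ 2 by rewrite -mulr_natr divfK.
have sh : sin h = 0.
  apply/eqP; rewrite -sqrf_eq0; apply/eqP.
  by move: c12; rewrite eh cos_mulr2n cos2sin2 -mulr_natr; lra.
suff h0 : h = 0 by apply/eqP; rewrite -subr_eq0 eh h0 mul0rn.
have hb : - pi < h < pi by rewrite /h; lra.
have [hlt|hgt|//] := ltgtP h 0; exfalso.
- have : 0 < sin (- h) by apply: sin_gt0_pi; lra.
  by rewrite sinN sh oppr0 ltxx.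
- have : 0 < sin h by apply: sin_gt0_pi; lra.
  by rewrite sh ltxx.
Qed.

End Excess.

(** * Feet of the mediators *)

Section Mediator.
Set Implicit Arguments.
Unset Strict Implicit.
Variable R : realType.
Implicit Types (V a b c d f u v w : 'rV[R]_3) (i j k A B C s t : R) (P : set 'rV[R]_3).

(* A is the cosine of half the angle between the unit vectors b and c *)
Definition half_cos b c A := 0 < A /\ dot b c = 2 * A ^+ 2 - 1.

Lemma half_cos_exists a b c : dot b b = 1 -> dot c c = 1 ->
  triple a b c != 0 -> exists A, half_cos b c A /\ A < 1.
Proof.
move=> b1 c1 D0; have : dot b c ^+ 2 < 1.
  by apply: (dot_unit_lt1 (c := a)) => //; rewrite triple_cyc.
move=> x1; have [xl xr] : -1 < dot b c /\ dot b c < 1 by split; nra.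
have x0 : 0 < (1 + dot b c) / 2 by lra.
exists (Num.sqrt ((1 + dot b c) / 2)); split; first split.
- by rewrite sqrtr_gt0.
- by rewrite sqr_sqrtr ?ltW//; field.
- by rewrite -[ltRHS]sqrtr1 ltr_sqrt//; lra.
Qed.

(** The determinants of the two parts are [t] and [s] times [triple a b c], whose absolute value
    cancels when the cotangents are compared. *)
Lemma excess_split a b c s t f :
    [/\ dot a a = 1, dot b b = 1 & dot c c = 1] -> triple a b c != 0 ->
    0 < s -> 0 < t -> f = s *: b + t *: c -> dot f f = 1 ->
  excess a b f = excess a f c <->
  s * excess_num a b f = t * excess_num a f c.
Proof.
move=> [a1 b1 c1] D0 s0 t0 ef f1.
have eb : triple a b f = t * triple a b c by rewrite ef triple_comb.
have ec : triple a f c = s * triple a b c by rewrite ef triple_comb2.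
rewrite eq_excess_unit ?eb ?ec ?mulf_neq0 ?(lt0r_neq0 s0) ?(lt0r_neq0 t0)//.
rewrite !normrM (gtr0_norm s0) (gtr0_norm t0) !mulrA.
have d0 : `|triple a b c| != 0 by rewrite normr_eq0.
rewrite (mulrC s) (mulrC t); split=> [/(mulIf d0)//|->//].
Qed.

(** Arranged by [L = s C^2 + t B^2] and [Q = s C^2 - t B^2], so that equal excesses read
    [Q = - (s - t) L]. *)
Lemma excess_num_split a b c A B C s t f :
    [/\ dot a a = 1, dot b b = 1 & dot c c = 1] ->
    half_cos b c A -> half_cos c a B -> half_cos a b C ->
    f = s *: b + t *: c ->
  s * excess_num a b f - t * excess_num a f c =
  2 * ((s - t) * (s * C ^+ 2 + t * B ^+ 2) + (s * C ^+ 2 - t * B ^+ 2)).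
Proof.
move=> [a1 b1 c1] [_ x] [_ y] [_ z] ->.
rewrite /excess_num !dotL (dotC b a) (dotC a c) b1 c1 x y z; ring.
Qed.

Lemma dot_comb b c A s t : dot b b = 1 -> dot c c = 1 -> half_cos b c A ->
  dot (s *: b + t *: c) (s *: b + t *: c) = (s - t) ^+ 2 + 4 * s * t * A ^+ 2.
Proof. by move=> b1 c1 [_ x]; rewrite !dotL (dotC c b) b1 c1 x; ring. Qed.

(** One has [L^2 - Q^2 = 4 s t (B C)^2], and the unit length of [f] gives
    [1 - (s - t)^2 = 4 s t A^2]. Substituting [Q = - (s - t) L] yields [(A L)^2 = (B C)^2], where
    [A L] and [B C] are positive. *)
Lemma foot_equation a b c A B C s t f :
    [/\ dot a a = 1, dot b b = 1 & dot c c = 1] -> triple a b c != 0 ->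
    half_cos b c A -> half_cos c a B -> half_cos a b C ->
    0 < s -> 0 < t -> f = s *: b + t *: c -> dot f f = 1 ->
    excess a b f = excess a f c ->
  A * (s * C ^+ 2 + t * B ^+ 2) = B * C.
Proof.
move=> abc1 D0 hA hB hC s0 t0 ef f1 /(excess_split abc1 D0 s0 t0 ef f1).
move/eqP; rewrite -subr_eq0 (excess_num_split abc1 hA hB hC ef) mulf_eq0 pnatr_eq0 /=.
move=> /eqP hPQ; move: f1; have [a1 b1 c1] := abc1.
rewrite ef (dot_comb _ _ b1 c1 hA).
move: hA hB hC => [A0 _] [B0 _] [C0 _] e1.
set L := s * C ^+ 2 + t * B ^+ 2; set Q := s * C ^+ 2 - t * B ^+ 2.
have L0 : 0 < L by rewrite addr_gt0// mulr_gt0 ?exprn_gt0.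
have eQ : Q = - ((s - t) * L) by apply/eqP; rewrite -addr_eq0 addrC hPQ.
have eL : L ^+ 2 - Q ^+ 2 = 4 * s * t * (B * C) ^+ 2 by rewrite /L /Q; ring.
have st0 : 4 * s * t != 0 by rewrite !mulf_neq0 ?pnatr_eq0 ?gt_eqF.
have : (A * L) ^+ 2 = (B * C) ^+ 2.
  apply: (mulfI st0); rewrite -eL eQ.
  have -> : 4 * s * t * (A * L) ^+ 2 = (4 * s * t * A ^+ 2) * L ^+ 2 by ring.
  have -> : 4 * s * t * A ^+ 2 = 1 - (s - t) ^+ 2 by lra.
  ring.
by move/eqP; rewrite eqrXn2// ?mulr_ge0 ?ltW// => /eqP.
Qed.

Lemma foot_exists a b c A B C :
    [/\ dot a a = 1, dot b b = 1 & dot c c = 1] -> triple a b c != 0 ->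
    half_cos b c A -> half_cos c a B -> half_cos a b C ->
  exists s t f, [/\ 0 < s, 0 < t, f = s *: b + t *: c, dot f f = 1 &
    excess a b f = excess a f c].
Proof.
move=> abc1 D0 hA hB hC; have [a1 b1 c1] := abc1.
have [[[A0 _] [B0 _]] [C0 _]] := (hA, hB, hC).
(* With [L = B C / A], the condition [Q = - (s - t) L] is linear and fixes the ratio
   [s : t = B (A B + C) : C (A C + B)]; dividing by [K] then gives [L] this value. *)
pose K := A * (B ^+ 2 + C ^+ 2 + 2 * A * B * C).
have K0 : 0 < B ^+ 2 + C ^+ 2 + 2 * A * B * C.
  by rewrite !addr_gt0 ?exprn_gt0 ?mulr_gt0.
pose s := B * (A * B + C) / K; pose t := C * (A * C + B) / K.
have s0 : 0 < s by rewrite /s /K divr_gt0 ?mulr_gt0 ?addr_gt0 ?mulr_gt0.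
have t0 : 0 < t by rewrite /t /K divr_gt0 ?mulr_gt0 ?addr_gt0 ?mulr_gt0.
have f1 : dot (s *: b + t *: c) (s *: b + t *: c) = 1.
  rewrite (dot_comb _ _ b1 c1 hA) /s /t /K; field.
  by rewrite !gt_eqF.
exists s, t, (s *: b + t *: c); split=> //.
apply/(excess_split abc1 D0 s0 t0 erefl f1)/eqP.
rewrite -subr_eq0 (excess_num_split abc1 hA hB hC erefl) /s /t /K; apply/eqP.
by field; rewrite !gt_eqF.
Qed.

Lemma ray_scale V f k : 0 < k -> ray V (k *: f) = ray V f.
Proof.
move=> k0; apply/seteqP; split=> _ [s s0 ->]; rewrite /ray /=.
- by exists (s * k); rewrite ?scalerA// mulr_ge0// ltW.
- exists (s / k); first by rewrite divr_ge0// ltW.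
  by rewrite scalerA divfK// gt_eqF.
Qed.

Lemma mediator_foot V a b c A B C i j k P :
    [/\ dot a a = 1, dot b b = 1 & dot c c = 1] -> triple a b c != 0 ->
    half_cos b c A -> half_cos c a B -> half_cos a b C ->
    0 < i -> 0 < j -> 0 < k -> mediator V (i *: a) (j *: b) (k *: c) P ->
  exists s t f, [/\ [/\ 0 < s, 0 < t & f = s *: b + t *: c], dot f f = 1,
    A * (s * C ^+ 2 + t * B ^+ 2) = B * C &
    P `&` face V (j *: b) (k *: c) = ray V f].
Proof.
move=> abc1 D0 hA hB hC i0 j0 k0 [_ _ [g [Pg /free3P gb /free3P gc eg]]].
(* The point [V + g] lies in the face, so [g] has nonnegative coordinates there; nondegeneracy of
   the two parts makes them nonzero. *)
have : ray V g (V + g) by exists 1; rewrite ?scale1r.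
rewrite -Pg => -[_ [s [t [s0 t0]]]]; rewrite -addrA => /addrI e.
move: gb; rewrite e triple_comb mulf_eq0 negb_or => /andP[t_neq0 _].
move: gc; rewrite e triple_comb2 mulf_eq0 negb_or => /andP[s_neq0 _].
have sp : 0 < s by rewrite lt_neqAle eq_sym s_neq0.
have tp : 0 < t by rewrite lt_neqAle eq_sym t_neq0.
have n0 : 0 < enorm g.
  rewrite lt_neqAle enorm_ge0 andbT eq_sym -sqrf_eq0 enorm_sqr.
  apply: contra_neq D0 => /dot_eq0 g0.
  have : triple a b g = t * k * triple a b c.
    by rewrite e !scalerA triple_comb.
  have -> : triple a b g = 0 by rewrite g0 tripleE !mxE; ring.
  by move=> /esym/eqP; rewrite !mulf_eq0 (negPf t_neq0) (gt_eqF k0) /= => /eqP.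
have ef : (enorm g)^-1 *: g = (s * j / enorm g) *: b + (t * k / enorm g) *: c.
  by rewrite e scalerDr !scalerA ![_ / _ in RHS]mulrC.
have f1 : dot ((enorm g)^-1 *: g) ((enorm g)^-1 *: g) = 1.
  by rewrite !dotL -enorm_sqr; field; rewrite gt_eqF.
have sn : 0 < s * j / enorm g by rewrite divr_gt0 ?mulr_gt0.
have tn : 0 < t * k / enorm g by rewrite divr_gt0 ?mulr_gt0.
exists (s * j / enorm g), (t * k / enorm g), ((enorm g)^-1 *: g).
split=> //; last by rewrite ray_scale ?invr_gt0.
apply: (foot_equation abc1 D0 hA hB hC sn tn ef f1).
move: eg; rewrite -[X in excess _ _ X = _](scale1r g) -[X in _ = excess _ X _](scale1r g) !excessZ// => eg.
by rewrite -(scale1r a) -(scale1r b) -(scale1r c) !excessZ ?invr_gt0.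
Qed.

Lemma mediator_exists V a b c A B C i j k :
    [/\ dot a a = 1, dot b b = 1 & dot c c = 1] -> triple a b c != 0 ->
    half_cos b c A -> half_cos c a B -> half_cos a b C ->
    0 < i -> 0 < j -> 0 < k ->
  exists P, mediator V (i *: a) (j *: b) (k *: c) P.
Proof.
move=> abc1 D0 hA hB hC i0 j0 k0.
have [s [t [f [s0 t0 ef f1 eE]]]] := foot_exists abc1 D0 hA hB hC.
(* These products make [n] orthogonal to [a] and to [f = s b + t c], so it is normal to the desired
   plane. *)
have [n [na nb nc]] := dual_vector 0 t (- s) D0.
have n0 : n != 0.
  by apply: contraTneq t0 => n0; rewrite -nb n0 dot0l ltxx.
exists (plane_at V n); split.
- by exists V, n.
- by move=> _ [m _ ->]; rewrite /plane_at /= addrC addKr !dotL (dotC a) na !mulr0.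
exists f; split.
- apply/seteqP; split=> [Q [Qn [s' [t' [s'0 t'0 eQ]]]]|_ [m m0 ->]].
    move: Qn; rewrite {Q}eQ.
    rewrite -addrA /plane_at /= (addrC V) addrK !dotL (dotC b) (dotC c) nb nc => e.
    rewrite /ray /=; exists (s' * j / s); first by rewrite divr_ge0 ?mulr_ge0// ltW.
    rewrite ef addrC scalerDr !scalerA; congr (_ + (_ *: _ + _ *: _)).
      by rewrite divfK ?gt_eqF.
    apply: (mulIf (lt0r_neq0 s0)); rewrite [RHS]mulrAC divfK ?gt_eqF//; lra.
  split; first by rewrite /plane_at /= addrC addKr ef !dotL (dotC b) (dotC c) nb nc; ring.
  exists (m * s / j), (m * t / k); split.
  - by rewrite divr_ge0 ?mulr_ge0// ltW.
  - by rewrite divr_ge0 ?mulr_ge0// ltW.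
  by rewrite !scalerA !divfK ?gt_eqF// ef scalerDr !scalerA addrA.
- apply/free3P; rewrite -[f]scale1r triple_scale ef triple_comb.
  by rewrite !mulf_neq0 ?oner_neq0// lt0r_neq0.
- apply/free3P; rewrite -[f]scale1r triple_scale ef triple_comb2.
  by rewrite !mulf_neq0 ?oner_neq0// lt0r_neq0.
- by rewrite -[f]scale1r !excessZ.
Qed.

End Mediator.

(** * The axis of the Euler cone and the centres of the tangent spheres *)

Section Hart.
Set Implicit Arguments.
Unset Strict Implicit.
Variable R : realType.
Implicit Types (V a b c d f o u v w O : 'rV[R]_3).
Implicit Types (i j k l r s t A B C p q m D : R) (P : set 'rV[R]_3).

(** Prescribing the products with the edges determines the axis when they are independent, and lets
    its norm be computed in the dual basis. *)
Definition hart_axis a b c A B C u :=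
  [/\ dot u a = B * C / A, dot u b = C * A / B & dot u c = A * B / C].

(** The two products give [f . u = A (s C^2 + t B^2) / (B C)], which the foot equation makes 1. *)
Lemma hart_axis_foot b c A B C s t f u : 0 < A -> 0 < B -> 0 < C ->
    f = s *: b + t *: c -> A * (s * C ^+ 2 + t * B ^+ 2) = B * C ->
    dot u b = C * A / B -> dot u c = A * B / C ->
  dot f u = 1.
Proof.
move=> A0 B0 C0 -> e ub uc; rewrite dotC !dotL ub uc.
have BC : B * C != 0 by rewrite mulf_neq0 ?lt0r_neq0.
by apply: (mulIf BC); rewrite mul1r -{2}e; field; rewrite !lt0r_neq0.
Qed.

Lemma triple_half_cos a b c A B C :
    [/\ dot a a = 1, dot b b = 1 & dot c c = 1] ->
    half_cos b c A -> half_cos c a B -> half_cos a b C ->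
  triple a b c ^+ 2 = 1
    + 2 * (2 * A ^+ 2 - 1) * (2 * B ^+ 2 - 1) * (2 * C ^+ 2 - 1)
    - (2 * A ^+ 2 - 1) ^+ 2 - (2 * B ^+ 2 - 1) ^+ 2 - (2 * C ^+ 2 - 1) ^+ 2.
Proof.
by move=> [a1 b1 c1] [_ x] [_ y] [_ z]; rewrite gram a1 b1 c1 x y z; ring.
Qed.

(** After expansion in the dual basis only the squares of [p], [q], [m] occur, so any choice of
    signs is allowed. *)
Lemma hart_axis_norm a b c A B C u p q m :
    [/\ dot a a = 1, dot b b = 1 & dot c c = 1] -> triple a b c != 0 ->
    half_cos b c A -> half_cos c a B -> half_cos a b C ->
    hart_axis a b c A B C u ->
    p ^+ 2 = 1 - A ^+ 2 -> q ^+ 2 = 1 - B ^+ 2 -> m ^+ 2 = 1 - C ^+ 2 ->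
  dot u u = 1 + (2 * p * q * m / triple a b c) ^+ 2.
Proof.
move=> abc1 D0 hA hB hC [ua ub uc] p2 q2 m2.
have D2 := triple_half_cos abc1 hA hB hC.
apply: (mulfI (expf_neq0 2 D0)).
transitivity (dot (triple a b c *: u) (triple a b c *: u)).
  by rewrite !dotL; ring.
rewrite triple_cross_decomp ua ub uc !dotL !dot_cross.
move: abc1 (hA) (hB) (hC) => [-> -> ->] [A0 x] [B0 y] [C0 z].
rewrite (dotC c b) (dotC a c) (dotC b a) x y z [RHS]mulrDr.
have -> : triple a b c ^+ 2 * (2 * p * q * m / triple a b c) ^+ 2
   = 4 * p ^+ 2 * q ^+ 2 * m ^+ 2 by field.
by rewrite D2 p2 q2 m2; field; rewrite !lt0r_neq0.
Qed.

(** Cramer's rule makes both sides quadratic in the signed half-sines. Their mixed terms agree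
    because [C^2 - m^2 = 2 C^2 - 1] is the product of [a] and [b], and cyclically. *)
Lemma tangent_center a b c A B C o p q m r :
    [/\ dot a a = 1, dot b b = 1 & dot c c = 1] -> triple a b c != 0 ->
    half_cos b c A -> half_cos c a B -> half_cos a b C ->
    p ^+ 2 = 1 - A ^+ 2 -> q ^+ 2 = 1 - B ^+ 2 -> m ^+ 2 = 1 - C ^+ 2 ->
    dot o (cross b c) = 2 * r * A * p -> dot o (cross c a) = 2 * r * B * q ->
    dot o (cross a b) = 2 * r * C * m ->
  dot o o = (2 * r / triple a b c
      * (p * B * C + A * q * C + A * B * m - p * q * m)) ^+ 2 + r ^+ 2.
Proof.
move=> abc1 D0 hA hB hC p2 q2 m2 oa ob oc.
have D2 := triple_half_cos abc1 hA hB hC.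
apply: (mulfI (expf_neq0 2 D0)).
transitivity (dot (triple a b c *: o) (triple a b c *: o)).
  by rewrite !dotL; ring.
rewrite triple_decomp oa ob oc !dotL.
move: abc1 (hA) (hB) (hC) => [-> -> ->] [A0 x] [B0 y] [C0 z].
rewrite (dotC c b) (dotC a c) (dotC b a) x y z [RHS]mulrDr.
set S := _ - p * q * m.
have -> : triple a b c ^+ 2 * (2 * r / triple a b c * S) ^+ 2
   = 4 * r ^+ 2 * S ^+ 2 by field.
have -> : S ^+ 2 = p ^+ 2 * B ^+ 2 * C ^+ 2 + A ^+ 2 * q ^+ 2 * C ^+ 2
    + A ^+ 2 * B ^+ 2 * m ^+ 2 + p ^+ 2 * q ^+ 2 * m ^+ 2
    + 2 * A * B * p * q * (C ^+ 2 - m ^+ 2)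
    + 2 * B * C * q * m * (A ^+ 2 - p ^+ 2)
    + 2 * C * A * m * p * (B ^+ 2 - q ^+ 2) by rewrite /S; ring.
rewrite p2 q2 m2.
set lhs := (X in X = _).
have -> : lhs = 4 * r ^+ 2 * (A ^+ 2 * p ^+ 2 + B ^+ 2 * q ^+ 2 + C ^+ 2 * m ^+ 2
    + 2 * A * B * p * q * (2 * C ^+ 2 - 1)
    + 2 * B * C * q * m * (2 * A ^+ 2 - 1)
    + 2 * C * A * m * p * (2 * B ^+ 2 - 1)) by rewrite /lhs; ring.
by rewrite D2 p2 q2 m2; ring.
Qed.

Lemma hart_axis_center a b c A B C o p q m r u :
    triple a b c != 0 -> 0 < A -> 0 < B -> 0 < C ->
    hart_axis a b c A B C u ->
    dot o (cross b c) = 2 * r * A * p -> dot o (cross c a) = 2 * r * B * q ->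
    dot o (cross a b) = 2 * r * C * m ->
  dot o u = 2 * r / triple a b c * (p * B * C + A * q * C + A * B * m).
Proof.
move=> D0 A0 B0 C0 [ua ub uc] oa ob oc; apply: (mulfI D0).
rewrite -dotZl triple_decomp oa ob oc !dotL (dotC a) (dotC b) (dotC c) ua ub uc.
by field; rewrite D0 !lt0r_neq0.
Qed.

(** With the apex at 0, the axis [u] and the centre [o], the point of contact is [l w]. The last
    equation makes the normals of cone and sphere parallel there; solved for [w] it reads
    [w = (k o - r u) / (l k - r)]. *)
Lemma tangent_generator o u v k l r : 0 < r ->
    dot u u = 1 + k ^+ 2 -> dot o o = l ^+ 2 + r ^+ 2 -> dot o u = l + r * k ->
    dot v v = 1 -> dot v u = 1 ->
  exists w, [/\ dot w w = 1, dot w u = 1, dot w o = l &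
    r *: (u - w) = k *: (o - l *: w)].
Proof.
move=> r0 uu oo ou vv vu.
(* The squared length of [o - l u] is [(l k - r)^2]. If it vanishes, the centre is on the axis,
   contact is along a whole circle, and the given generator [v] serves. *)
have [m0|m0] := eqVneq (l * k) r.
  have eo : o = l *: u.
    apply/eqP; rewrite -subr_eq0; apply/eqP/dot_eq0.
    rewrite !dotL (dotC u o) uu oo ou -m0; ring.
  exists v; split=> //; first by rewrite eo !dotL vu mulr1.
  by rewrite eo -m0 -!scalerBr scalerA mulrC.
have m1 : l * k - r != 0 by rewrite subr_eq0.
exists ((l * k - r)^-1 *: (k *: o - r *: u)); split.
- by rewrite !dotL (dotC u o) uu oo ou; field.
- by rewrite !dotL uu ou; field.
- by rewrite !dotL (dotC u o) oo ou; field.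
- by apply/row3P; rewrite !mxE; field.
Qed.

Lemma plane_atZ V n k : k != 0 -> plane_at V (k *: n) = plane_at V n.
Proof.
move=> k0; apply/seteqP; split=> Q; rewrite /plane_at /= dotZr.
  by move/eqP; rewrite mulf_eq0 (negPf k0) => /eqP.
by move->; rewrite mulr0.
Qed.

(** The normal is [T - O], the radius to the point of contact [T]. *)
Lemma tangent_plane_dot V b c j k O r P : j != 0 -> k != 0 ->
    P V -> P (V + j *: b) -> P (V + k *: c) -> sphere_tangent_to_plane O r P ->
  exists n, [/\ dot n b = 0, dot n c = 0, dot n n = r ^+ 2 & dot (O - V) n = - r ^+ 2].
Proof.
move=> j0 k0 PV Pb Pc [T ET eP]; move: PV Pb Pc.
rewrite -eP /sphere_tangent_plane /plane_at /= => V0 Vb Vc.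
have NN : dot (T - O) (T - O) = r ^+ 2 by rewrite -enorm_sqr ET.
exists (T - O); split=> //.
- have := Vb; rewrite addrAC (dotDl (V - T)) V0 add0r dotZl => /eqP.
  by rewrite mulf_eq0 (negPf j0) dotC => /eqP.
- have := Vc; rewrite addrAC (dotDl (V - T)) V0 add0r dotZl => /eqP.
  by rewrite mulf_eq0 (negPf k0) dotC => /eqP.
- have -> : O - V = (- (V - T)) + - (T - O) by apply/rowP => i; rewrite !mxE; ring.
  by rewrite dotDl !dotNl V0 NN oppr0 add0r.
Qed.

(** Since [n] is a nonzero multiple of [cross b c], the distance [r] from the centre to the face
    plane can be read off along either normal. *)
Lemma tangent_plane_cross a b c o n r : 0 < r -> triple a b c != 0 ->
    dot n b = 0 -> dot n c = 0 -> dot n n = r ^+ 2 -> dot o n = - r ^+ 2 ->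
  dot o (cross b c) ^+ 2 = r ^+ 2 * dot (cross b c) (cross b c).
Proof.
move=> r0 D0 nb nc nn on.
have Dn : triple a b c *: n = dot n a *: cross b c.
  by rewrite triple_cross_decomp nb nc !scale0r !addr0.
have r2 : r ^+ 2 != 0 by rewrite expf_neq0 ?lt0r_neq0.
have e1 : triple a b c ^+ 2 * r ^+ 2 = dot n a ^+ 2 * dot (cross b c) (cross b c).
  have := congr1 (fun v => dot v v) Dn; rewrite !dotL nn => e.
  by rewrite !expr2 -!mulrA e.
have e2 : triple a b c * - r ^+ 2 = dot n a * dot o (cross b c).
  by have := congr1 (dot o) Dn; rewrite !dotL on.
have na0 : dot n a ^+ 2 != 0.
  apply: contra_neq (mulf_neq0 (expf_neq0 2 D0) r2) => na.
  by rewrite e1 na mul0r.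
apply: (mulfI na0); rewrite -exprMn -e2 mulrCA -e1; ring.
Qed.

(* If O were at the distance r from V, all three points of contact would be V. *)
Lemma tangent_center_neq a b c o r : 0 < r -> triple a b c != 0 ->
    dot o (cross b c) ^+ 2 = r ^+ 2 * dot (cross b c) (cross b c) ->
    dot o (cross c a) ^+ 2 = r ^+ 2 * dot (cross c a) (cross c a) ->
    dot o (cross a b) ^+ 2 = r ^+ 2 * dot (cross a b) (cross a b) ->
  dot o o != r ^+ 2.
Proof.
move=> r0 D0 oa ob oc; apply/eqP => oo.
(* If [o] has length [r], this is equality in Cauchy-Schwarz: [o] is parallel to the normal of each
   face, hence orthogonal to every edge. *)
have orth u v : cross u v != 0 ->
    dot o (cross u v) ^+ 2 = r ^+ 2 * dot (cross u v) (cross u v) ->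
    dot o u = 0 /\ dot o v = 0.
  move=> n0 on; have nn0 : dot (cross u v) (cross u v) != 0.
    by apply: contra_neq n0 => /dot_eq0.
  have e : dot (cross u v) (cross u v) *: o = dot o (cross u v) *: cross u v.
    apply/eqP; rewrite -subr_eq0; apply/eqP/dot_eq0.
    rewrite !dotL (dotC (cross u v) o) oo.
    set N := dot (cross u v) (cross u v) in on *.
    by transitivity (N * (r ^+ 2 * N - dot o (cross u v) ^+ 2)); [ring|rewrite on subrr mulr0].
  split; apply: (mulfI nn0); rewrite -dotZl e dotZl (dotC (cross u v)).
    by rewrite dot_crossl !mulr0.
  by rewrite dot_crossr !mulr0.
have bc0 : cross b c != 0 by apply: contra_neq D0 => e; rewrite /triple e dotC dot0l.
have ca0 : cross c a != 0.
  by apply: contra_neq D0 => e; rewrite -triple_cyc /triple e dotC dot0l.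
have [ob0 oc0] := orth _ _ bc0 oa; have [_ oa0] := orth _ _ ca0 ob.
have o0 : o = 0 by apply: (eq_dual_vector D0); rewrite dot0l.
by move: oo; rewrite o0 dot0l => /esym/eqP; rewrite expf_eq0 /= gt_eqF.
Qed.

Lemma cone_tangent_to_sphere_of V u v k l r theta O : 0 < r -> l != 0 ->
    0 < enorm u * cos theta ->
    u = (enorm u * cos theta) *: v ->
    dot v v = 1 + k ^+ 2 -> k != 0 ->
    dot (O - V) (O - V) = l ^+ 2 + r ^+ 2 -> dot (O - V) v = l + r * k ->
    (exists f, dot f f = 1 /\ dot f v = 1) ->
  cone_tangent_to_sphere V u theta O r.
Proof.
set h := enorm u * cos theta; have [y ey] : exists y, y = O - V.
  by exists (O - V).
rewrite -ey.
move=> r0 l0 h0 eu vv k0 oo ov [f [ff fv]].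
have [w [ww wv wo ew]] := tangent_generator r0 vv oo ov ff fv.
have XV : V + l *: w - V = l *: w by rewrite addrC addKr.
have XO : V + l *: w - O = l *: w - y by rewrite ey opprB addrCA addrA.
have nw : enorm (l *: w) = `|l|.
  by rewrite /enorm !dotL ww mulr1 -expr2 sqrtr_sqr.
have wu : dot (l *: w) u = h * l by rewrite eu !dotL wv mulr1 mulrC.
exists (V + l *: w); split.
- rewrite -subr_eq0 XV; apply: contra_neq l0 => e.
  by apply/eqP; rewrite -normr_eq0 -nw e /enorm dot0l sqrtr0.
- rewrite /circular_cone /nappe /= XV nw wu.
  (* The sign of [l] decides which of the two nappes carries the point of contact. *)
  have [l_ge0|l_lt0] := leP 0 l; [left|right]; rewrite -mulrA.
    by rewrite -/h (ger0_norm l_ge0) mulrC.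
  have -> : enorm (- u) = enorm u by rewrite /enorm dotNl dotNr opprK.
  by rewrite dotNr wu -/h ltr0_norm// mulNr mulrC.
- rewrite /sphere /= XO /enorm !dotL ww (dotC y w) wo oo.
  transitivity (Num.sqrt (r ^+ 2)); first by congr Num.sqrt; ring.
  by rewrite sqrtr_sqr gtr0_norm.
rewrite /cone_tangent_plane /sphere_tangent_plane XV XO wu.
have -> : cos theta ^+ 2 * dot u u = h ^+ 2.
  by rewrite -enorm_sqr /h exprMn mulrC.
(* The last equation of [tangent_generator] turns the cone's normal into a multiple of the radius,
   with a nonzero factor as [k] and [l] are nonzero. *)
have -> : (h * l) *: u - h ^+ 2 *: (l *: w) = (- (h ^+ 2 / r * l * k)) *: (l *: w - y).
  have rr : r != 0 by rewrite lt0r_neq0.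
  transitivity ((h ^+ 2 * l / r) *: (r *: (v - w))).
    by rewrite eu !scalerA divfK// scalerBr; congr (_ *: _ - _); ring.
  rewrite ew -opprB !scalerN scaleNr scalerA; congr (- (_ *: _)); ring.
have hr : h ^+ 2 / r != 0 by rewrite lt0r_neq0// divr_gt0// exprn_gt0.
by rewrite plane_atZ// oppr_eq0 (mulf_neq0 _ k0)// mulf_neq0.
Qed.

End Hart.

(** * The Euler cone *)

Section EulerCone.
Set Implicit Arguments.
Unset Strict Implicit.
Variable R : realType.
Implicit Types (V a b c d f u v w O : 'rV[R]_3).
Implicit Types (i j k l r s t A B C p q m D theta : R) (P : set 'rV[R]_3).

Lemma mediator_nappe V a b c A B C i j k P u v theta :
    [/\ dot a a = 1, dot b b = 1 & dot c c = 1] -> triple a b c != 0 ->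
    half_cos b c A -> half_cos c a B -> half_cos a b C ->
    0 < i -> 0 < j -> 0 < k -> mediator V (i *: a) (j *: b) (k *: c) P ->
    dot v b = C * A / B -> dot v c = A * B / C ->
    P `&` face V (j *: b) (k *: c) `<=` nappe V u theta ->
  exists s t f, [/\ [/\ 0 < s, 0 < t & f = s *: b + t *: c], dot f f = 1,
    dot f v = 1 & dot f u = enorm u * cos theta].
Proof.
move=> abc1 D0 hA hB hC i0 j0 k0 hP vb vc PN.
have [s [t [f [[s0 t0 ef] f1 e Pf]]]] :=
  mediator_foot abc1 D0 hA hB hC i0 j0 k0 hP.
have [[[A0 _] [B0 _]] [C0 _]] := (hA, hB, hC).
exists s, t, f; split=> //; first exact: hart_axis_foot ef e vb vc.
have /PN : (P `&` face V (j *: b) (k *: c)) (V + f).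
  by rewrite Pf; exists 1; rewrite ?scale1r.
by rewrite /nappe /= addrC addKr (enorm_unit f1) mul1r.
Qed.

(** The determinant is [s1 s2 s3 + t1 t2 t3 > 0]; in other words, the three feet are linearly
    independent. *)
Lemma cyclic_system_eq0 s1 t1 s2 t2 s3 t3 (x y z : R) :
    0 < s1 -> 0 < s2 -> 0 < s3 -> 0 < t1 -> 0 < t2 -> 0 < t3 ->
    s1 * y + t1 * z = 0 -> s2 * z + t2 * x = 0 -> s3 * x + t3 * y = 0 ->
  x = 0.
Proof.
move=> s10 s20 s30 t10 t20 t30 e1 e2 e3.
have m0 : s1 * s2 * s3 + t1 * t2 * t3 != 0.
  by rewrite lt0r_neq0// addr_gt0 ?mulr_gt0.
apply: (mulfI m0); rewrite mulr0.
transitivity (s1 * s2 * (s3 * x + t3 * y) - s2 * t3 * (s1 * y + t1 * z)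
  + t1 * t3 * (s2 * z + t2 * x)); first by ring.
by rewrite e1 e2 e3; ring.
Qed.

(** Uniqueness of the Euler cone: each unit foot has product 1 with [v] and
    [h = enorm u * cos theta] with [u], so [u - h v] is orthogonal to three independent vectors. *)
Lemma euler_cone_axis V a b c A B C i j k u v theta :
    [/\ dot a a = 1, dot b b = 1 & dot c c = 1] -> triple a b c != 0 ->
    half_cos b c A -> half_cos c a B -> half_cos a b C ->
    hart_axis a b c A B C v ->
    0 < i -> 0 < j -> 0 < k ->
    euler_cone V (i *: a) (j *: b) (k *: c) u theta ->
  [/\ 0 < enorm u * cos theta, u = (enorm u * cos theta) *: v &
      exists f, dot f f = 1 /\ dot f v = 1].
Proof.
move=> [a1 b1 c1] D0 hA hB hC [va vb vc] i0 j0 k0.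
have cyc1 : triple b c a != 0 by rewrite triple_cyc.
have cyc2 : triple c a b != 0 by rewrite -triple_cyc.
case=> u0 /andP[th0 th1] [Pa [Pb [Pc [[Ma Mb Mc] [Na Nb Nc]]]]].
have [s1 [t1 [f1 [[s10 t10 ef1] ff fv fu1]]]] := mediator_nappe
  (And3 a1 b1 c1) D0 hA hB hC i0 j0 k0 Ma vb vc Na.
have [s2 [t2 [f2 [[s20 t20 ef2] _ fv2 fu2]]]] := mediator_nappe
  (And3 b1 c1 a1) cyc1 hB hC hA j0 k0 i0 Mb vc va Nb.
have [s3 [t3 [f3 [[s30 t30 ef3] _ fv3 fu3]]]] := mediator_nappe
  (And3 c1 a1 b1) cyc2 hC hA hB k0 i0 j0 Mc va vb Nc.
set h := enorm u * cos theta in fu1 fu2 fu3 *.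
have h0 : 0 < h.
  rewrite mulr_gt0 ?cos_gt0_pihalf ?th1 ?andbT//.
    rewrite lt_neqAle enorm_ge0 andbT eq_sym -sqrf_eq0 enorm_sqr.
    by apply: contra_neq u0 => /dot_eq0.
  by rewrite (lt_trans _ th0)// oppr_lt0 divr_gt0 ?pi_gt0.
split=> //; last by exists f1.
have orth f : dot f v = 1 -> dot f u = h -> dot f (u - h *: v) = 0.
  by move=> fv' fu; rewrite !dotL fv' fu mulr1 subrr.
have := orth _ fv fu1; have := orth _ fv2 fu2; have := orth _ fv3 fu3.
rewrite ef1 ef2 ef3 !(dotDl, dotZl) => g3 g2 g1.
have ea := cyclic_system_eq0 s10 s20 s30 t10 t20 t30 g1 g2 g3.
have eb := cyclic_system_eq0 s20 s30 s10 t20 t30 t10 g2 g3 g1.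
have ec := cyclic_system_eq0 s30 s10 s20 t30 t10 t20 g3 g1 g2.
apply/eqP; rewrite -subr_eq0; apply/eqP.
by apply: (eq_dual_vector D0); rewrite dot0l dotC.
Qed.

(** The cosine [1 / enorm v] lies strictly between 0 and 1. *)
Lemma unit_axis_angle v : 1 < dot v v ->
  exists theta, 0 < theta < pi / 2 /\ enorm v * cos theta = 1.
Proof.
move=> v1; have n1 : 1 < enorm v.
  by rewrite -(ltr_pXn2r (n := 2)) ?nnegrE ?enorm_ge0// expr1n enorm_sqr.
have n0 : 0 < enorm v by apply: lt_trans n1.
have i1 : (enorm v)^-1 < 1 by rewrite invf_lt1.
have i0 : 0 < (enorm v)^-1 by rewrite invr_gt0.
exists (acos (enorm v)^-1); split; last first.
  rewrite acosK ?mulfV ?gt_eqF// in_itv/= (ltW i1) andbT.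
  by apply: le_trans (ltW i0); rewrite lerN10.
have iN : -1 <= (enorm v)^-1 by apply: le_trans (ltW i0); rewrite lerN10.
rewrite acos_gt0 ?iN//= -ltr_cos ?in_itv/=.
- by rewrite cos_pihalf acosK// in_itv/= iN ltW.
- by rewrite acos_ge0 ?acos_lepi ?iN ?ltW.
- by rewrite divr_ge0 ?pi_ge0//= ler_pdivrMr// ler_peMr ?pi_ge0// ler1n.
Qed.

Lemma mediator_nappe_exists V a b c A B C i j k v theta :
    [/\ dot a a = 1, dot b b = 1 & dot c c = 1] -> triple a b c != 0 ->
    half_cos b c A -> half_cos c a B -> half_cos a b C ->
    0 < i -> 0 < j -> 0 < k ->
    dot v b = C * A / B -> dot v c = A * B / C -> enorm v * cos theta = 1 ->
  exists P, mediator V (i *: a) (j *: b) (k *: c) P /\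
    P `&` face V (j *: b) (k *: c) `<=` nappe V v theta.
Proof.
move=> abc1 D0 hA hB hC i0 j0 k0 vb vc vth.
have [P hP] := mediator_exists V abc1 D0 hA hB hC i0 j0 k0.
exists P; split=> //.
have [s [t [f [[s0 t0 ef] f1 e ->]]]] :=
  mediator_foot abc1 D0 hA hB hC i0 j0 k0 hP.
have [[[A0 _] [B0 _]] [C0 _]] := (hA, hB, hC).
move=> _ [m m0 ->]; rewrite /nappe /= addrC addKr -mulrA vth mulr1 enormZ//.
by rewrite (enorm_unit f1) dotZl (hart_axis_foot A0 B0 C0 ef e vb vc).
Qed.

Lemma half_sin_exists A : A < 1 -> 0 < A -> exists p, p != 0 /\ p ^+ 2 = 1 - A ^+ 2.
Proof.
move=> A1 A0; have A2 : 0 < 1 - A ^+ 2 by nra.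
exists (Num.sqrt (1 - A ^+ 2)).
by rewrite sqr_sqrtr ?ltW// gt_eqF// sqrtr_gt0.
Qed.

Lemma euler_cone_exists V a b c A B C i j k v :
    [/\ dot a a = 1, dot b b = 1 & dot c c = 1] -> triple a b c != 0 ->
    half_cos b c A -> half_cos c a B -> half_cos a b C ->
    A < 1 -> B < 1 -> C < 1 -> hart_axis a b c A B C v ->
    0 < i -> 0 < j -> 0 < k ->
  exists theta, euler_cone V (i *: a) (j *: b) (k *: c) v theta.
Proof.
move=> abc1 D0 hA hB hC A1 B1 C1 hv i0 j0 k0.
have [a1 b1 c1] := abc1; have [va vb vc] := hv.
have [[[A0 _] [B0 _]] [C0 _]] := (hA, hB, hC).
have cyc1 : triple b c a != 0 by rewrite triple_cyc.
have cyc2 : triple c a b != 0 by rewrite -triple_cyc.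
have [p [p0 p2]] := half_sin_exists A1 A0.
have [q [q0 q2]] := half_sin_exists B1 B0.
have [m [m0 m2]] := half_sin_exists C1 C0.
have v1 : 1 < dot v v.
  rewrite (hart_axis_norm abc1 D0 hA hB hC hv p2 q2 m2) ltrDl lt_neqAle sqr_ge0.
  by rewrite andbT eq_sym sqrf_eq0 !mulf_neq0 ?pnatr_eq0 ?invr_eq0.
have [theta [th vth]] := unit_axis_angle v1; exists theta; split=> //.
  by apply: contraTneq v1 => ->; rewrite dot0l ltr10.
have [Pa [Ma Na]] := mediator_nappe_exists V (And3 a1 b1 c1) D0 hA hB hC i0 j0 k0 vb vc vth.
have [Pb [Mb Nb]] := mediator_nappe_exists V (And3 b1 c1 a1) cyc1 hB hC hA j0 k0 i0 vc va vth.
have [Pc [Mc Nc]] := mediator_nappe_exists V (And3 c1 a1 b1) cyc2 hC hA hB k0 i0 j0 va vb vth.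
by exists Pa, Pb, Pc.
Qed.

(** Here [cross b c] has squared length [4 A^2 (1 - A^2)]. The sign of [p] records on which side of
    the face plane the centre lies. *)
Lemma tangent_plane_half_sin V a b c A j k O r P :
    [/\ dot a a = 1, dot b b = 1 & dot c c = 1] -> triple a b c != 0 ->
    half_cos b c A -> A < 1 -> 0 < j -> 0 < k -> 0 < r ->
    P V -> P (V + j *: b) -> P (V + k *: c) -> sphere_tangent_to_plane O r P ->
  dot (O - V) (cross b c) ^+ 2 = r ^+ 2 * dot (cross b c) (cross b c) /\
  exists p, [/\ p != 0, p ^+ 2 = 1 - A ^+ 2 &
    dot (O - V) (cross b c) = 2 * r * A * p].
Proof.
move=> [a1 b1 c1] D0 [A0 hA] A1 j0 k0 r0 PV Pb Pc OP.
have [n [nb nc nn on]] :=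
  tangent_plane_dot (lt0r_neq0 j0) (lt0r_neq0 k0) PV Pb Pc OP.
have e := tangent_plane_cross r0 D0 nb nc nn on; split=> //.
have nz : 2 * r * A != 0 by rewrite lt0r_neq0// !mulr_gt0.
exists (dot (O - V) (cross b c) / (2 * r * A)).
have p2 : (dot (O - V) (cross b c) / (2 * r * A)) ^+ 2 = 1 - A ^+ 2.
  rewrite expr_div_n e dot_cross b1 c1 (dotC c b) hA; field.
  by rewrite !lt0r_neq0.
split=> //; last by rewrite mulrC divfK.
by rewrite -sqrf_eq0 p2 gt_eqF//; nra.
Qed.

Lemma euler_cone_tangent V a b c A B C i j k v u theta O r (Pa Pb Pc : set 'rV[R]_3) :
    [/\ dot a a = 1, dot b b = 1 & dot c c = 1] -> triple a b c != 0 ->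
    half_cos b c A -> half_cos c a B -> half_cos a b C ->
    A < 1 -> B < 1 -> C < 1 -> hart_axis a b c A B C v ->
    0 < i -> 0 < j -> 0 < k ->
    euler_cone V (i *: a) (j *: b) (k *: c) u theta -> 0 < r ->
    [/\ Pa V, Pa (V + j *: b), Pa (V + k *: c) & sphere_tangent_to_plane O r Pa] ->
    [/\ Pb V, Pb (V + k *: c), Pb (V + i *: a) & sphere_tangent_to_plane O r Pb] ->
    [/\ Pc V, Pc (V + i *: a), Pc (V + j *: b) & sphere_tangent_to_plane O r Pc] ->
  cone_tangent_to_sphere V u theta O r.
Proof.
move=> abc1 D0 hA hB hC A1 B1 C1 hv i0 j0 k0 hu r0.
move=> [Pa1 Pa2 Pa3 Pa4] [Pb1 Pb2 Pb3 Pb4] [Pc1 Pc2 Pc3 Pc4].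
have [a1 b1 c1] := abc1.
have [[[A0 _] [B0 _]] [C0 _]] := (hA, hB, hC).
have cyc1 : triple b c a != 0 by rewrite triple_cyc.
have cyc2 : triple c a b != 0 by rewrite -triple_cyc.
have [h0 eu vf] := euler_cone_axis abc1 D0 hA hB hC hv i0 j0 k0 hu.
have [ea [p [p0 p2 oa]]] := tangent_plane_half_sin (And3 a1 b1 c1) D0 hA A1
  j0 k0 r0 Pa1 Pa2 Pa3 Pa4.
have [eb [q [q0 q2 ob]]] := tangent_plane_half_sin (And3 b1 c1 a1) cyc1 hB B1
  k0 i0 r0 Pb1 Pb2 Pb3 Pb4.
have [ec [m [m0 m2 oc]]] := tangent_plane_half_sin (And3 c1 a1 b1) cyc2 hC C1
  i0 j0 r0 Pc1 Pc2 Pc3 Pc4.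
have oo := tangent_center abc1 D0 hA hB hC p2 q2 m2 oa ob oc.
have ov := hart_axis_center D0 A0 B0 C0 hv oa ob oc.
have vv := hart_axis_norm abc1 D0 hA hB hC hv p2 q2 m2.
(* This rules out [l = 0], which would place the point of contact at the vertex of the cone. *)
have := tangent_center_neq r0 D0 ea eb ec; rewrite {1}oo => l_neq0.
apply: (cone_tangent_to_sphere_of r0 _ h0 eu vv _ oo _ vf).
- by apply: contra_neq l_neq0 => ->; rewrite expr0n add0r.
- by rewrite !mulf_neq0 ?pnatr_eq0 ?invr_eq0.
(* The term [- p q m] in [l] cancels against [r k]. *)
- by rewrite ov; field.
Qed.

Lemma trihedral_normalize a b c : triple a b c != 0 ->
  exists i j k a' b' c', [/\ [/\ 0 < i, 0 < j & 0 < k],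
    [/\ a = i *: a', b = j *: b' & c = k *: c'],
    [/\ dot a' a' = 1, dot b' b' = 1 & dot c' c' = 1] & triple a' b' c' != 0].
Proof.
move=> D0.
have norm v : v != 0 -> [/\ 0 < enorm v, v = enorm v *: ((enorm v)^-1 *: v) &
    dot ((enorm v)^-1 *: v) ((enorm v)^-1 *: v) = 1].
  move=> v0; have n0 : 0 < enorm v.
    rewrite lt_neqAle enorm_ge0 andbT eq_sym -sqrf_eq0 enorm_sqr.
    by apply: contra_neq v0 => /dot_eq0.
  split=> //; first by rewrite scalerA divff ?scale1r// gt_eqF.
  by rewrite !dotL -enorm_sqr; field; rewrite gt_eqF.
have [] := norm a.
  by apply: contra_neq D0 => ->; rewrite /triple dot0l.
move=> a0 ea a1; have [] := norm b.
  by apply: contra_neq D0 => ->; rewrite -triple_cyc /triple dot0l.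
move=> b0 eb b1; have [] := norm c.
  by apply: contra_neq D0 => ->; rewrite -triple_cyc -triple_cyc /triple dot0l.
move=> c0 ec c1.
exists (enorm a), (enorm b), (enorm c), ((enorm a)^-1 *: a), ((enorm b)^-1 *: b).
exists ((enorm c)^-1 *: c); split=> //.
by rewrite triple_scale !mulf_neq0 ?invr_neq0// lt0r_neq0.
Qed.

Lemma hart_axis_exists a b c A B C : triple a b c != 0 ->
  exists v, hart_axis a b c A B C v.
Proof. exact: dual_vector. Qed.

(** The face planes enter as sets through three given points, so the order of the vertices in
    [plane3] does not matter. *)
Lemma euler_cone_trihedral V a b c : triple a b c != 0 ->
  (exists u theta, euler_cone V a b c u theta) /\
  (forall u theta, euler_cone V a b c u theta ->
   forall O r (Pa Pb Pc : set 'rV[R]_3), 0 < r ->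
    [/\ Pa V, Pa (V + b), Pa (V + c) & sphere_tangent_to_plane O r Pa] ->
    [/\ Pb V, Pb (V + c), Pb (V + a) & sphere_tangent_to_plane O r Pb] ->
    [/\ Pc V, Pc (V + a), Pc (V + b) & sphere_tangent_to_plane O r Pc] ->
    cone_tangent_to_sphere V u theta O r).
Proof.
move=> /trihedral_normalize[i [j [k [a' [b' [c' [[i0 j0 k0] [-> -> ->] abc1 D0]]]]]]].
move: a' b' c' abc1 D0 => {}a {}b {}c abc1 D0; have [a1 b1 c1] := abc1.
have [A [hA A1]] := half_cos_exists b1 c1 D0.
have [B [hB B1]] : exists B, half_cos c a B /\ B < 1.
  by apply: (@half_cos_exists _ b) => //; rewrite triple_cyc.
have [C [hC C1]] : exists C, half_cos a b C /\ C < 1.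
  by apply: (@half_cos_exists _ c) => //; rewrite -triple_cyc.
have [v hv] := hart_axis_exists A B C D0.
split; last first.
  move=> u theta hu O r Pa Pb Pc r0.
  exact: (euler_cone_tangent abc1 D0 hA hB hC A1 B1 C1 hv i0 j0 k0 hu r0).
have [theta ?] := euler_cone_exists V abc1 D0 hA hB hC A1 B1 C1 hv i0 j0 k0.
by exists v, theta.
Qed.

(** * The four vertices of the tetrahedron *)

Lemma plane3_1 (X Y Z : 'rV[R]_3) : plane3 X Y Z X.
Proof. by exists 0, 0; rewrite !scale0r !addr0. Qed.

Lemma plane3_2 (X Y Z : 'rV[R]_3) : plane3 X Y Z Y.
Proof. by exists 1, 0; rewrite scale0r addr0 scale1r addrC subrK. Qed.

Lemma plane3_3 (X Y Z : 'rV[R]_3) : plane3 X Y Z Z.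
Proof. by exists 0, 1; rewrite scale0r addr0 scale1r addrC subrK. Qed.

(** Changing the vertex changes the determinant at most by its sign, so all four trihedral angles
    are nondegenerate. *)
Lemma triple_vertex (A B C D : 'rV[R]_3) :
  [/\ triple (A - B) (C - B) (D - B) = - triple (B - A) (C - A) (D - A),
      triple (A - C) (B - C) (D - C) = triple (B - A) (C - A) (D - A) &
      triple (A - D) (B - D) (C - D) = - triple (B - A) (C - A) (D - A)].
Proof. by split; rewrite !tripleE !mxE; ring. Qed.

End EulerCone.

Theorem mainTheorem2 (R : realType) (A B C D : 'rV[R]_3)
  (tetrahedron : free [:: B - A; C - A; D - A])
  (general_form :
    ([set s : 'rV[R]_3 * R | tangent_sphere A B C D s.1 s.2] #= `I_8)%card) :
  forall V X Y Z : 'rV[R]_3,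
    (V, X, Y, Z) \in [:: (A, B, C, D); (B, A, C, D); (C, A, B, D); (D, A, B, C)] ->
    (exists (u : 'rV[R]_3) (theta : R),
       euler_cone V (X - V) (Y - V) (Z - V) u theta) /\
    (forall (u : 'rV[R]_3) (theta : R),
       euler_cone V (X - V) (Y - V) (Z - V) u theta ->
       forall (O : 'rV[R]_3) (r : R), tangent_sphere A B C D O r ->
         cone_tangent_to_sphere V u theta O r).
Proof.
move=> V X Y Z hV.
have /free3P D0 := tetrahedron; have [tB tC tD] := triple_vertex A B C D.
have addV (P Q : 'rV[R]_3) : P + (Q - P) = Q by rewrite addrC subrK.
(* Three of the four face planes pass through [V]; they are listed in the cyclic order of the
   edges. *)
have [T0 hP] : triple (X - V) (Y - V) (Z - V) != 0 /\
    forall O r, tangent_sphere A B C D O r -> exists Pa Pb Pc : set 'rV[R]_3,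
    [/\ [/\ Pa V, Pa Y, Pa Z & sphere_tangent_to_plane O r Pa],
        [/\ Pb V, Pb Z, Pb X & sphere_tangent_to_plane O r Pb] &
        [/\ Pc V, Pc X, Pc Y & sphere_tangent_to_plane O r Pc]].
  move: hV; rewrite !inE.
  case/or4P => /eqP[-> -> -> ->].
  - split=> [|O r [_ [? ? ? ?]]]; first by rewrite D0.
    by exists (plane3 A C D), (plane3 A B D), (plane3 A B C); split; split=> //;
      do [exact: plane3_1 | exact: plane3_2 | exact: plane3_3].
  - split=> [|O r [_ [? ? ? ?]]]; first by rewrite tB oppr_eq0.
    by exists (plane3 B C D), (plane3 A B D), (plane3 A B C); split; split=> //;
      do [exact: plane3_1 | exact: plane3_2 | exact: plane3_3].
  - split=> [|O r [_ [? ? ? ?]]]; first by rewrite tC.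
    by exists (plane3 B C D), (plane3 A C D), (plane3 A B C); split; split=> //;
      do [exact: plane3_1 | exact: plane3_2 | exact: plane3_3].
  - split=> [|O r [_ [? ? ? ?]]]; first by rewrite tD oppr_eq0.
    by exists (plane3 B C D), (plane3 A C D), (plane3 A B D); split; split=> //;
      do [exact: plane3_1 | exact: plane3_2 | exact: plane3_3].
have [ex tg] := euler_cone_trihedral V T0; split=> // u theta hu O r hO.
have [r0 _] := hO; have [Pa [Pb [Pc [ha hb hc]]]] := hP O r hO.
by apply: (tg u theta hu O r Pa Pb Pc r0); rewrite !addV.
Qed.
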